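(* A complete clique $a$ in an edge-colored graph is exact Gallai if and only if there exist a tree $T$ and a $2$-coloring $\widehat{\bullet}$ of the sibling graph $S(T)$ together with a color-preserving bijection from $a$ onto the leaf graph $K(T)$ such that every factor is irreducible and simple, and higher factors use different colors than lower factors, i.e., for non-leaves $t_1<t_2$ no color occurs both among the edges of the factor at $t_1$ and among the edges of the factor at $t_2$.
   Context: A clique is a complete subgraph induced by a nonempty vertex set, with the restricted coloring. $a$ is exact Gallai if every triangle in it has edges of exactly two distinct colors. A tree is a finite poset in which every pair of unrelated elements has a common upper bound but no common lower bound; parent/child is the covering relation; siblings are unrelated elements with a common parent; leaves are elements with no children. $S(T)$ has vertex set $T$ and edges between siblings; a coloring $\widehat{\bullet}$ of $S(T)$ is a $2$-coloring if for each non-leaf $t$ the edges among children of $t$ use at most two colors. $K(T)$ is the complete graph on the leaves colored by $\overline{st}=\widehat{uv}$, where $u,v$ are the siblings with $s\le u$, $t\le v$. The factor at a non-leaf $t$ is the set of children of $t$, as a complete colored graph with colors $\widehat{rs}$. A partition of a clique into nonempty disjoint subcliques is homogeneous if for any two distinct blocks all edges between them have the same color, nontrivial if it has at least two blocks and not all blocks are singletons; a clique is irreducible if it has no nontrivial homogeneous partition. A monochrome of a colored complete graph is a connected component of the graph formed by the edges of one color. $P_3$ is the path on 4 vertices, $C_5$ the 5-cycle. A clique $a$ is simple if $|a|=2$, or $|a|=4$ and $a$ has two monochromes isomorphic to $P_3$, or $|a|=5$ and $a$ has two monochromes isomorphic to $C_5$.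
   Formalization: The edge-colored graph is taken to be finite (an infinite clique can be exact Gallai, e.g. the natural numbers with edge ij colored min(i,j), but trees are finite); a finite clique in any graph is covered via its induced subgraph; equality of colors is assumed decidable. *)

(* Defs.v *)
From HB Require Import structures.
From mathcomp Require Import all_boot all_order.

Set Implicit Arguments.
Unset Strict Implicit.
Unset Printing Implicit Defensive.

Import Order.TTheory.

Local Open Scope order_scope.

(* An edge coloring is a function on ordered pairs of vertices that is symmetric
   on adjacent pairs; its values at other pairs are never used. *)
Definition edge_coloring (V C : Type) (e : rel V) (col : V -> V -> C) : Prop :=
  forall x y, e x y -> col x y = col y x.

Definition is_clique (V : finType) (e : rel V) (A : {set V}) : Prop :=
  A != set0 /\ {in A &, forall x y, x != y -> e x y}.

(* The remaining definitions of this section are meant for the clique induced by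
   a vertex set A, in which any two distinct vertices are adjacent. *)
Section ColoredCliques.
Variables (V : finType) (C : eqType) (col : V -> V -> C).
Implicit Types (A B : {set V}) (P : {set {set V}}).

Definition edge_colors A : seq C :=
  undup [seq col p.1 p.2 | p in [set p in setX A A | p.1 != p.2]].

Definition exact_gallai A : Prop :=
  forall B, B \subset A -> #|B| = 3 -> size (edge_colors B) = 2.

Definition homogeneous P : Prop :=
  forall B1 B2, B1 \in P -> B2 \in P -> B1 != B2 ->
  forall x1 y1 x2 y2, x1 \in B1 -> y1 \in B1 -> x2 \in B2 -> y2 \in B2 ->
    col x1 x2 = col y1 y2.

Definition nontrivial P : Prop :=
  (1 < #|P|)%N /\ exists2 B, B \in P & #|B| != 1.

Definition irreducible A : Prop :=
  ~ exists P, [/\ partition P A, homogeneous P & nontrivial P].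

Definition color_edge A (c : C) : rel V :=
  [rel x y | [&& x \in A, y \in A, x != y & col x y == c]].

(* A monochrome is represented by its color and its vertex set. The graph formed
   by the edges of color c has as vertices the endpoints of those edges, so a
   monochrome has at least one edge, and m is determined by the subgraph. *)
Definition monochrome A (m : C * {set V}) : Prop :=
  exists x y, color_edge A m.1 x y
              /\ m.2 = [set z | connect (color_edge A m.1) x z].

Definition monochrome_iso A (m : C * {set V}) n (H : rel 'I_n) : Prop :=
  exists f : 'I_n -> V,
    [/\ injective f, f @: [set: 'I_n] = m.2
      & forall i j, color_edge A m.1 (f i) (f j) = H i j].

Definition two_monochromes_iso A n (H : rel 'I_n) : Prop :=
  exists m1 m2, [/\ m1 != m2, monochrome A m1, monochrome A m2,
    monochrome_iso A m1 H & monochrome_iso A m2 H].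

Definition path_P3 : rel 'I_4 :=
  [rel i j : 'I_4 | (i.+1 == j :> nat) || (j.+1 == i :> nat)].

Definition cycle_C5 : rel 'I_5 :=
  [rel i j : 'I_5 | (i.+1 == j %[mod 5]) || (j.+1 == i %[mod 5])].

Definition simple A : Prop :=
  [\/ #|A| = 2,
      #|A| = 4 /\ two_monochromes_iso A path_P3
    | #|A| = 5 /\ two_monochromes_iso A cycle_C5].

End ColoredCliques.

Section Trees.
Variables (d : Order.disp_t) (T : finPOrderType d).
Implicit Types s t u v : T.

Definition is_tree : Prop :=
  forall s t, s >< t ->
    (exists u, s <= u /\ t <= u) /\ ~ (exists u, u <= s /\ u <= t).

(* Parents lie above their children, so the root of a tree is its maximum. *)
Definition children t : {set T} :=
  [set s | (s < t) && ~~ [exists u, s < u < t]].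

Definition leaf t : bool := children t == set0.

Definition leaves : {set T} := [set t | leaf t].

Definition sibling : rel T :=
  [rel u v | (u >< v) && [exists t, (u \in children t) && (v \in children t)]].

Variable C : eqType.

Definition two_coloring (hat : T -> T -> C) : Prop :=
  edge_coloring sibling hat /\
  forall t, ~~ leaf t -> (size (edge_colors hat (children t)) <= 2)%N.

(* The coloring of K(T). For distinct leaves s and t of a tree the pair (u, v)
   exists and is unique (leaf_color_spec below); the default value is only
   there to make the function total. *)
Definition leaf_color (hat : T -> T -> C) s t : C :=
  if [pick p : T * T | [&& sibling p.1 p.2, s <= p.1 & t <= p.2]] is Some p
  then hat p.1 p.2 else hat s t.

End Trees.
Arguments is_tree {d} T.
Arguments leaves {d} T.

Section TreeFacts.
Variables (d : Order.disp_t) (T : finPOrderType d).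
Hypothesis treeT : is_tree T.
Implicit Types s t u v : T.

Lemma tree_chain s u v : s <= u -> s <= v -> u >=< v.
Proof.
move=> su sv; case: (boolP (u >=< v)) => // /treeT [_ []].
by exists s.
Qed.

Lemma child_lt s t : s \in children t -> s < t.
Proof. by rewrite inE => /andP[]. Qed.

Lemma child_above s t w : s \in children t -> s < w -> t >=< w -> t <= w.
Proof.
rewrite inE => /andP[_ /existsPn nb] sw.
case: comparableP => // wt _.
by have := nb w; rewrite sw wt.
Qed.

Lemma exists_child s w : s < w -> exists2 u, s <= u & u \in children w.
Proof.
have [n] := ubnP #|[set u | s < u < w]|; elim: n s => // n IHn s; rewrite ltnS => le_n sw.
case: (boolP [exists u, s < u < w]) => [/existsP[u /andP[su uw]]|nex].
  have [|//|v uv vw] := IHn u; last by exists v; rewrite ?(le_trans (ltW su)).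
  apply: leq_trans le_n; apply: proper_card.
  apply/properP; split.
    by apply/subsetP=> v; rewrite !inE => /andP[/(lt_trans su)-> ->].
  by exists u; rewrite !inE ?su ?uw ?ltxx.
by exists s; rewrite ?lexx // inE sw.
Qed.

Lemma siblings_exist s t : s >< t ->
  exists u v, [/\ sibling u v, s <= u & t <= v].
Proof.
move=> st; have [[w [sw tw]] _] := treeT st; move: sw tw.
have [n] := ubnP #|[set u | u < w]|; elim: n w => // n IHn w; rewrite ltnS => le_n sw tw.
have {}sw : s < w.
  rewrite lt_neqAle sw andbT; apply: contraNneq st => ->.
  by rewrite comparable_sym le_comparable.
have {}tw : t < w.
  by rewrite lt_neqAle tw andbT; apply: contraNneq st => ->; rewrite le_comparable // ltW.
have [u su uw] := exists_child sw; have [v tv vw] := exists_child tw.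
have lower (x : T) : x < w -> s <= x -> t <= x ->
    exists u v, [/\ sibling u v, s <= u & t <= v].
  move=> xw; apply: IHn; apply: leq_trans le_n.
  apply: proper_card; apply/properP; split.
    by apply/subsetP=> y; rewrite !inE => /lt_trans->.
  by exists x; rewrite !inE ?ltxx.
case: (boolP (u >=< v)) => [/orP[le_uv|le_vu]|uv].
- by apply: (lower v); rewrite ?(child_lt vw) // (le_trans su).
- by apply: (lower u); rewrite ?(child_lt uw) // (le_trans tv).
- exists u, v; split=> //; rewrite /sibling /= uv.
  by apply/existsP; exists w; rewrite uw vw.
Qed.

Lemma siblings_uniq s t u v u' v' :
  sibling u v -> s <= u -> t <= v ->
  sibling u' v' -> s <= u' -> t <= v' -> u = u' /\ v = v'.
Proof.
have aux (x y z w p q : T) : x >< y -> s <= x -> s <= z -> t <= y -> t <= w ->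
    x \in children p -> y \in children p ->
    z \in children q -> w \in children q -> ~ q < p.
  move=> xy sx sz ty tw xp yp zq wq qp.
  have le_q (c c' r : T) : c \in children p -> c' \in children q ->
      r <= c -> r <= c' -> q <= c.
    move=> cp c'q rc rc'; have /orP[//|cq] :=
      tree_chain (le_trans rc' (ltW (child_lt c'q))) rc.
    move: cq; rewrite le_eqVlt => /predU1P[->//|cq].
    by move: cp; rewrite inE => /andP[_ /existsPn/(_ q)]; rewrite cq qp.
  have [_ []] := treeT xy; exists q.
  by rewrite (le_q x z s) ?(le_q y w t).
have eqc (c c' p r : T) : c \in children p -> c' \in children p ->
    r <= c -> r <= c' -> c = c'.
  move=> cp c'p rc rc'; have := tree_chain rc rc'.
  case: comparableP => // lt _.
    by move: cp; rewrite inE => /andP[_ /existsPn/(_ c')]; rewrite lt child_lt.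
  by move: c'p; rewrite inE => /andP[_ /existsPn/(_ c)]; rewrite lt child_lt.
move=> /andP[uv /existsP[p /andP[up vp]]] su tv.
move=> /andP[uv' /existsP[q /andP[uq vq]]] su' tv'.
have := tree_chain (le_trans su (ltW (child_lt up)))
                   (le_trans su' (ltW (child_lt uq))).
case: comparableP => // [pq|qp|epq] _.
- by case: (aux u' v' u v q p).
- by case: (aux u v u' v' p q).
- by subst q; split; [apply: (eqc _ _ p s) | apply: (eqc _ _ p t)].
Qed.

Lemma leaf_color_spec (C : eqType) (hat : T -> T -> C) s t :
  leaf s -> leaf t -> s != t ->
  exists u v, [/\ sibling u v, s <= u, t <= v & leaf_color hat s t = hat u v].
Proof.
move=> ls lt nst; have nlt (x y : T) : leaf y -> ~~ (x < y).
  move=> /eqP ly; apply/negP=> /exists_child[u _]; by rewrite ly inE.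
have st : s >< t.
  rewrite /Order.comparable !le_eqVlt [t == s]eq_sym (negPf nst) /=.
  by rewrite (negPf (nlt _ _ ls)) (negPf (nlt _ _ lt)).
have [u [v [uv su tv]]] := siblings_exist st.
rewrite /leaf_color; case: pickP => [[u' v'] /and3P[/= ? ? ?]|/(_ (u, v))/=].
  by exists u', v'.
by rewrite uv su tv.
Qed.

Lemma leaf_colorE (C : eqType) (hat : T -> T -> C) s t u v :
  sibling u v -> s <= u -> t <= v -> leaf_color hat s t = hat u v.
Proof.
move=> uv su tv.
rewrite /leaf_color; case: pickP => [[u' v'] /and3P[/= sib su' tv']|/(_ (u, v))/=].
  by have [-> ->] := siblings_uniq sib su' tv' uv su tv.
by rewrite uv su tv.
Qed.

End TreeFacts.

(* Main.v *)
From HB Require Import structures.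
Require Import Defs.
From mathcomp Require Import all_boot all_order.

Set Implicit Arguments.
Unset Strict Implicit.
Unset Printing Implicit Defensive.

Import Order.TTheory.

(** A color whose graph is disconnected has components that form a homogeneous
    partition, because an edge whose color changes across a component would give
    a rainbow triangle. So in an irreducible exact Gallai clique every color that
    occurs is connected and spanning. Three such colors cannot coexist: they would
    remain connected after deletion of any vertex, down to two vertices. With at
    most two colors and no monochromatic triangle, every vertex has at most two
    neighbors in each color, which leaves an edge, P3 or C5.

    The tree consists of the subsets of [a] reached by repeatedly splitting a set
    into a homogeneous partition with as few blocks as possible; minimality makes
    the factors irreducible. In a simple factor every vertex meets every color of
    the factor, so a repetition of one of these colors inside a block would close
    a monochromatic triangle. Conversely, the edges of a triangle of leaves lie in
    one simple factor or in two comparable factors, two of the edges sharing a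
    color in the latter case. *)

(** * Connected colors *)

Section Colorings.
Variables (V : finType) (C : eqType) (col : V -> V -> C).
Implicit Types (A B : {set V}) (P Q : {set {set V}}) (c : C).

Definition symmetric_on A := {in A &, forall x y, x != y -> col x y = col y x}.

(** Among three colors the number of equal pairs is 0, 1 or 3, so the sum is 1 exactly when two
    distinct colors occur. *)
Definition two_colored (p q r : C) : bool :=
  (p == q) + (q == r) + (p == r) == 1.

Lemma two_coloredE p q r :
  two_colored p q r = (size (undup [:: p; q; r]) == 2).
Proof.
rewrite /two_colored /= !inE.
have [epq|npq] := eqVneq p q; have [eqr|nqr] := eqVneq q r; subst => //=;
  rewrite ?eqxx ?(negPf npq) ?(negPf nqr) //=.
by case: (p == r).
Qed.

Lemma edge_colorsP A c :
  reflect (exists x y, [/\ x \in A, y \in A, x != y & col x y = c])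
          (c \in edge_colors col A).
Proof.
rewrite mem_undup; apply: (iffP imageP) => [[[x y]]|[x [y [xA yA nxy <-]]]].
  by rewrite !inE /= => /andP[/andP[xA yA] nxy] ->; exists x, y.
by exists (x, y); rewrite // !inE /= xA yA.
Qed.

Lemma symmetric_onS A B : B \subset A -> symmetric_on A -> symmetric_on B.
Proof. by move=> /subsetP sBA sym x y /sBA xA /sBA yA; apply: sym. Qed.

Lemma edge_colors3 x y z (B := [set x; y; z]) :
  symmetric_on B -> x != y -> y != z -> x != z ->
  size (edge_colors col B) = size (undup [:: col x y; col y z; col x z]).
Proof.
move=> sym nxy nyz nxz; apply/perm_size/uniq_perm; rewrite ?undup_uniq // => c.
have [xB yB zB] : [/\ x \in B, y \in B & z \in B] by rewrite !inE !eqxx !orbT.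
rewrite mem_undup !inE; apply/edge_colorsP/idP => [[u [v [uB vB nuv <-]]]|].
  have s := sym _ _ uB vB nuv; move: uB vB nuv s; rewrite !inE -!orbA.
  by do 2![case/or3P=> /eqP->]; rewrite ?eqxx //= => _ s; rewrite -?s ?eqxx ?orbT.
by case/or3P=> /eqP->; [exists x, y|exists y, z|exists x, z].
Qed.

Lemma exact_gallaiP A : symmetric_on A ->
  exact_gallai col A <->
  (forall x y z, x \in A -> y \in A -> z \in A ->
     x != y -> y != z -> x != z -> two_colored (col x y) (col y z) (col x z)).
Proof.
move=> sym; split=> [gal x y z xA yA zA nxy nyz nxz|gal B sBA cB].
  have sBA : [set x; y; z] \subset A.
    by apply/subsetP=> u; rewrite !inE -orbA => /or3P[] /eqP->.
  rewrite two_coloredE -edge_colors3 //; last exact: symmetric_onS sBA sym.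
  apply/eqP/gal => //.
  by rewrite setUC cardsU1 !inE negb_or ![z == _]eq_sym nxz nyz cards2 nxy.
have /card_gt2P[x [y [z [[xB yB zB] [nxy nyz nzx]]]]] : 2 < #|B| by rewrite cB.
have nxz : x != z by rewrite eq_sym.
have eB : B = [set x; y; z].
  apply/esym/eqP; rewrite eqEcard cB; apply/andP; split.
    by apply/subsetP=> u; rewrite !inE -orbA => /or3P[] /eqP->.
  by rewrite setUC cardsU1 !inE negb_or ![z == _]eq_sym nxz nyz cards2 nxy.
have symB := symmetric_onS sBA sym.
rewrite eB edge_colors3 //; last by rewrite -eB.
by apply/eqP; rewrite -two_coloredE; apply: gal => //; apply: (subsetP sBA).
Qed.

(** The color is required to span: all of [A] is reached, not only the endpoints of edges of color
    [c]. *)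
Definition connected_in A c :=
  {in A &, forall x y, connect (color_edge col A c) x y}.

Lemma connect_crossing (e : rel V) (S : pred V) x y :
  connect e x y -> S x -> ~~ S y -> exists u v, [/\ S u, ~~ S v & e u v].
Proof.
move=> /connectP[p + ->{y}]; elim: p x => [|z p IHp] x /=; first by move=> _ ->.
case/andP=> exz pz Sx nS.
by case: (boolP (S z)) => [Sz|nSz]; [apply: (IHp z) | exists x, z].
Qed.

Lemma color_edgeE A c x y :
  color_edge col A c x y = [&& x \in A, y \in A, x != y & col x y == c].
Proof. by []. Qed.

Lemma color_edge_sym A c : symmetric_on A -> symmetric (color_edge col A c).
Proof.
move=> sym x y; rewrite !color_edgeE eq_sym.
have [xA|_] := boolP (x \in A); have [yA|_] := boolP (y \in A) => //=.
by have [//|nyx] := boolP (y == x); rewrite [col y x]sym.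
Qed.

(** * Triangles and color components in exact Gallai cliques *)

Section NoRainbow.
Variable A : {set V}.
Hypothesis symA : symmetric_on A.
Hypothesis galA : exact_gallai col A.

Let tri x y z : x \in A -> y \in A -> z \in A ->
  x != y -> y != z -> x != z -> two_colored (col x y) (col y z) (col x z).
Proof. by move: x y z; apply/(exact_gallaiP symA). Qed.

Lemma no_rainbow x y z : x \in A -> y \in A -> z \in A ->
  x != y -> y != z -> x != z -> col x y != col x z -> col y z != col x z ->
  col x y = col y z.
Proof.
move=> xA yA zA nxy nyz nxz n1 n2; move: (tri xA yA zA nxy nyz nxz).
by rewrite /two_colored (negPf n1) (negPf n2); case: (col x y =P _).
Qed.

Lemma no_monochromatic x y z c : x \in A -> y \in A -> z \in A ->
  x != y -> y != z -> x != z -> col x y = c -> col y z = c -> col x z <> c.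
Proof.
move=> xA yA zA nxy nyz nxz xyc yzc xzc.
by move: (tri xA yA zA nxy nyz nxz); rewrite xyc yzc xzc /two_colored eqxx.
Qed.

(* A vertex outside a component of color [c] sees it in a single color: along
   an edge of color [c], a change of color would make a rainbow triangle. *)
Lemma component_homogeneous B c z s t : B \subset A -> z \in B -> s \in B ->
  ~~ connect (color_edge col B c) z s ->
  connect (color_edge col B c) s t -> col z s = col z t.
Proof.
move=> sBA zB sB + /connectP[p + ->{t}]; elim: p s sB => [//|u p IHp] s sB nzs /=.
case/andP=> su pu; move: (su) => /and4P[_ uB nsu /eqP csu].
have nzu : ~~ connect (color_edge col B c) z u.
  apply: contra nzs => zu; apply: connect_trans zu (connect1 _).
  by rewrite (color_edge_sym _ (symmetric_onS sBA symA)).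
rewrite -(IHp u) //; have sub := subsetP sBA.
have ns w : ~~ connect (color_edge col B c) z w -> z != w.
  by apply: contraNneq => ->; apply: connect0.
have nc w : w \in B -> ~~ connect (color_edge col B c) z w -> col z w != c.
  move=> wB nw; apply: contra (nw) => cw; apply: connect1.
  by rewrite color_edgeE zB wB cw (ns w).
move: (tri (sub _ zB) (sub _ sB) (sub _ uB) (ns _ nzs) nsu (ns _ nzu)).
rewrite csu /two_colored (negPf (nc _ _ nzs)) // [c == _]eq_sym.
by rewrite (negPf (nc _ _ nzu)) //=; case: (col z s =P _).
Qed.

Lemma connected_neighbor c v : connected_in A c -> 1 < #|A| -> v \in A ->
  exists x, [/\ x \in A, v != x & col v x = c].
Proof.
move=> conn /card_gt1P[y [z [yA zA nyz]]] vA.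
have [w wA nwv] : exists2 w, w \in A & w != v.
  by have [yv|?] := eqVneq y v; [exists z; rewrite // eq_sym -yv|exists y].
(* The crossing edge leaves the set consisting of [v] alone, so it starts at [v]. *)
have [_ [x [/eqP-> _ /and4P[_ ? ? /eqP ?]]]] :=
  connect_crossing (S := pred1 v) (conn _ _ vA wA) (eqxx v) nwv.
by exists x.
Qed.

End NoRainbow.

Lemma exact_gallaiS A B : B \subset A -> exact_gallai col A -> exact_gallai col B.
Proof. by move=> sBA gal D sDB; apply/gal/(subset_trans sDB). Qed.

(* If deleting [v] disconnects [c1], let ~ be connectivity by [c1] in [A - v].
   Every class of ~ contains a vertex joined to [v] by [c1], so a neighbor of [v]
   in another color [c] is joined by [c] to all other classes. This is
   contradictory for a [c2]-neighbor and a [c3]-neighbor of [v]. *)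
Lemma connected_delete A v c1 c2 c3 :
  symmetric_on A -> exact_gallai col A -> 1 < #|A| -> v \in A ->
  c1 != c2 -> c1 != c3 -> c2 != c3 ->
  connected_in A c1 -> connected_in A c2 -> connected_in A c3 ->
  connected_in (A :\ v) c1.
Proof.
move=> sym gal A1 vA n12 n13 n23 conn1 conn2 conn3 s0 t0 s0B t0B.
set B := A :\ v in s0B t0B *; set r := color_edge col B c1.
apply: contraT => nst.
have sBA : B \subset A := subsetDl _ _.
have symr : connect_sym r.
  exact/sym_connect_sym/color_edge_sym/(symmetric_onS sBA).
have inB x : x \in A -> v != x -> x \in B by rewrite !inE eq_sym => -> ->.
have [toA nev] : {subset B <= A} /\ forall x, x \in B -> v != x.
  by split=> x; rewrite !inE eq_sym => /andP[].
(* A path of color [c1] in [A] from [s] to [v] must leave the class of [s]. The edge by which it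
   leaves cannot stay inside [B], so it ends at [v]. *)
have adj s : s \in B -> exists t, [/\ connect r s t, t \in B & col v t = c1].
  move=> sB; have nsv : ~~ connect r s v.
    apply/negP; rewrite symr => /connectP[[|y p] /=].
      by move=> _ sv; move: sB; rewrite sv !inE eqxx.
    by case/andP=> /and4P[]; rewrite !inE eqxx.
  have [u [w [su nsw /and4P[uA wA nuw cuw]]]] :=
    connect_crossing (conn1 s v (toA _ sB) vA) (connect0 r s) nsv.
  have [wv|nvw] := eqVneq w v.
    subst w; exists u; split=> //; first by apply: inB; rewrite // eq_sym.
    by rewrite sym // 1?eq_sym //; apply/eqP.
  have uB : u \in B.
    apply: inB => //; apply: contraNneq nsv => ->; exact: su.
  case/negP: nsw; apply: connect_trans su (connect1 _).
  by rewrite /r color_edgeE uB nuw cuw inB // eq_sym.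
(* The class of [z] contains a vertex [y] joined to [v] by [c1]. In the triangle [v], [x], [y] no
   other edge has color [c1], so [xy] has the color [c] of [vx]; homogeneity carries this over to
   [xz]. *)
have spread x z c : c1 != c -> col v x = c -> x \in B -> z \in B ->
    ~~ connect r x z -> col x z = c.
  move=> nc vx xB zB nxz; have [y [zy yB vy]] := adj z zB.
  rewrite (component_homogeneous sym gal sBA xB zB nxz zy).
  have nxy : ~~ connect r x y.
    by apply: contra nxz => /connect_trans; apply; rewrite symr.
  have nexy : x != y by apply: contraNneq nxy => ->.
  have nc1 : col x y != c1.
    apply: contra (nxy) => cxy; apply: connect1.
    by rewrite /r color_edgeE xB yB nexy.
  apply/esym; rewrite -{1}vx; apply: (no_rainbow sym gal);
    by rewrite ?vx ?vy ?[c == _]eq_sym //; auto.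
have [x [xA nvx vx]] := connected_neighbor conn2 A1 vA.
have [y [yA nvy vy]] := connected_neighbor conn3 A1 vA.
have [xB yB] : x \in B /\ y \in B by split; apply: inB.
(* If [x] and [y] share a class, a vertex [z] outside sees that class in a single color, which would
   be both [c2] and [c3]. *)
case: (boolP (connect r x y)) => [xy|nxy].
  have [z zB nzx] : exists2 z, z \in B & ~~ connect r z x.
    case: (boolP (connect r s0 x)) => [s0x|?]; last by exists s0.
    exists t0 => //; apply: contra nst => t0x.
    by apply: connect_trans s0x _; rewrite symr.
  have nxz : ~~ connect r x z by rewrite symr.
  have nyz : ~~ connect r y z by apply: contra nxz; apply: connect_trans.
  have nzne w : ~~ connect r w z -> z != w.
    by apply: contraNneq => ->.
  have := component_homogeneous sym gal sBA zB xB nzx xy.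
  rewrite sym ?toA ?nzne // [col z y]sym ?toA ?nzne //.
  by rewrite (spread x z c2) // (spread y z c3) // => /eqP; rewrite (negPf n23).
(* If the classes differ, the edge [xy] itself gets both [c2] and [c3]. *)
have nyx : ~~ connect r y x by rewrite symr.
have nexy : x != y by apply: contraNneq nxy => ->.
have := spread x y c2 n12 vx xB yB nxy; rewrite sym ?toA //.
by rewrite (spread y x c3) // => /esym/eqP; rewrite (negPf n23).
Qed.

(** Deleting a vertex preserves connectedness of all three colors, so induction descends to two
    vertices, whose single edge would need two colors. *)
Lemma not_three_connected A c1 c2 c3 :
  symmetric_on A -> exact_gallai col A -> 1 < #|A| ->
  c1 != c2 -> c1 != c3 -> c2 != c3 ->
  connected_in A c1 -> connected_in A c2 -> connected_in A c3 -> False.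
Proof.
have [n] := ubnP #|A|; elim: n A => // n IHn A; rewrite ltnS => le_n.
move=> sym gal A1 n12 n13 n23 conn1 conn2 conn3.
have /card_gt0P[v vA] : 0 < #|A| by apply: leq_trans A1.
have [n21 n31 n32] : [/\ c2 != c1, c3 != c1 & c3 != c2] by rewrite !(eq_sym c3) eq_sym.
have sBA : A :\ v \subset A := subsetDl _ _.
have cB : #|A| = #|A :\ v|.+1 by rewrite (cardsD1 v) vA.
have [B1|B1] := ltnP 1 #|A :\ v|; last first.
  have [x [xA nvx vx]] := connected_neighbor conn1 A1 vA.
  have [y [yA nvy vy]] := connected_neighbor conn2 A1 vA.
  have /card_le1P/(_ x) := B1; rewrite !inE eq_sym nvx xA => /(_ isT y).
  rewrite !inE eq_sym nvy yA => /esym/eqP exy.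
  by move: n12; rewrite -vx -vy exy eqxx.
apply: (IHn (A :\ v)); rewrite -?cB //.
- exact: symmetric_onS sBA sym.
- exact: exact_gallaiS sBA gal.
- exact: connected_delete n12 n13 n23 conn1 conn2 conn3.
- exact: connected_delete n21 n23 n13 conn2 conn1 conn3.
- exact: connected_delete n31 n32 n12 conn3 conn1 conn2.
Qed.

(** The components of color [c] form a homogeneous partition, and the block of [x] also contains
    [y]. Irreducibility therefore leaves a single block. *)
Lemma irreducible_connected A c :
  symmetric_on A -> exact_gallai col A -> irreducible col A ->
  c \in edge_colors col A -> connected_in A c.
Proof.
move=> sym gal irr /edge_colorsP[x [y [xA yA nxy cxy]]].
set r := connect (color_edge col A c).
have symr : connect_sym (color_edge col A c).
  exact/sym_connect_sym/color_edge_sym.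
have eqv : {in A & &, equivalence_rel r}.
  move=> u v w _ _ _; split=> [|uv]; first exact: connect0.
  exact: same_connect.
set P := equivalence_partition r A.
have partP : partition P A := equivalence_partitionP eqv.
have inP B u v : B \in P -> u \in B -> (v \in B) = (v \in A) && r u v.
  case/imsetP=> w wA -> /=; rewrite !inE => /andP[uA wu].
  by rewrite /r (same_connect symr wu).
have sPA B u : B \in P -> u \in B -> u \in A.
  by move=> BP uB; have := uB; rewrite (inP B u) // => /andP[].
have dif B1 B2 u v : B1 \in P -> B2 \in P -> B1 != B2 -> u \in B1 -> v \in B2 -> ~~ r u v.
  move=> B1P B2P nB uB vB; apply: contra nB => ruv.
  apply/eqP/setP=> w; rewrite (inP B1 u) // (inP B2 v) //.
  by rewrite /r (same_connect symr ruv).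
have homP : homogeneous col P.
  move=> B1 B2 B1P B2P nB x1 y1 x2 y2 x1B y1B x2B y2B.
  have [x1A y1A x2A y2A] : [/\ x1 \in A, y1 \in A, x2 \in A & y2 \in A].
    by split; [apply: (sPA B1)|apply: (sPA B1)|apply: (sPA B2)|apply: (sPA B2)].
  have ne u v : u \in B1 -> v \in B2 -> u != v.
    move=> uB vB; apply: contraNneq (dif _ _ _ _ B1P B2P nB uB vB) => ->.
    exact: connect0.
  have r1 : r x1 y1 by have := y1B; rewrite (inP B1 x1) // => /andP[].
  have r2 : r x2 y2 by have := y2B; rewrite (inP B2 x2) // => /andP[].
  (* One endpoint is moved at a time; symmetry exchanges the roles of the two blocks in between. *)
  rewrite (component_homogeneous sym gal (subxx A) x1A x2A _ r2); last exact: dif x1B x2B.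
  rewrite sym ?ne // [RHS]sym ?ne //.
  rewrite (component_homogeneous sym gal (subxx A) y2A x1A _ r1) //.
  by apply: dif y2B x1B; rewrite // eq_sym.
move=> u v uA vA; apply: contraT => nuv; case: irr; exists P; split=> //.
have blk w : w \in A -> pblock P w \in P /\ w \in pblock P w.
  by move=> wA; rewrite pblock_mem ?mem_pblock ?(cover_partition partP).
have [[[uP uB] [vP vB]] [xP xB]] := (blk _ uA, blk _ vA, blk _ xA); split.
  apply/card_gt1P; exists (pblock P u), (pblock P v); split=> //.
  apply: contra nuv => /eqP euv; have := vB.
  by rewrite -euv (inP _ u) // => /andP[].
exists (pblock P x) => //; rewrite neq_ltn; apply/orP; right.
apply/card_gt1P; exists x, y; split=> //.
by rewrite (inP _ x) // yA; apply: connect1; rewrite color_edgeE xA yA nxy cxy eqxx.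
Qed.

End Colorings.

(** * Simple cliques *)

Section Simple.
Variables (V : finType) (C : eqType) (col : V -> V -> C).
Implicit Types (A B : {set V}) (c d : C).

Lemma connected_monochrome A c : 1 < #|A| -> connected_in col A c ->
  monochrome col A (c, A).
Proof.
move=> A1 conn; have /card_gt0P[x xA] : 0 < #|A| by apply: leq_trans A1.
have [y [yA nxy cxy]] := connected_neighbor conn A1 xA.
exists x, y; split; first by rewrite color_edgeE xA yA nxy; apply/eqP.
apply/setP=> z; rewrite inE; apply/idP/idP=> [zA|xz]; first exact: conn.
apply: contraT => nzA.
have [u [w [_ /negP nw]]] := connect_crossing (S := mem A) xz xA nzA.
by rewrite color_edgeE => /and4P[_ wA].
Qed.

(** Symmetry reduces an isomorphism to the pairs [i < j], a finite table of colors once the vertices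
    are listed. *)
Lemma monochrome_iso_tuple A c n (H : rel 'I_n) (t : n.-tuple V) :
  symmetric_on col A -> uniq t -> A =i t -> symmetric H -> irreflexive H ->
  (forall i j : 'I_n, i < j -> (col (tnth t i) (tnth t j) == c) = H i j) ->
  monochrome_iso col A (c, A) H.
Proof.
move=> sym un eA symH irrH tab; have inj := elimT (tuple_uniqP t) un.
exists (tnth t); split=> // [|i j].
  apply/setP=> u; rewrite eA; apply/imsetP/tnthP=> [[i _ ->]|[i ->]]; first by exists i.
  by exists i.
rewrite color_edgeE /= !eA !mem_tnth inj_eq //.
have [->|nij] /= := eqVneq i j; first by rewrite irrH.
have [ltij|ltji|/val_inj eij] := ltngtP i j; first exact: tab.
  by rewrite sym ?eA ?mem_tnth ?inj_eq // tab // symH.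
by rewrite eij eqxx in nij.
Qed.

Lemma path_P3_sym : symmetric path_P3.
Proof. by move=> i j; rewrite /path_P3 /= orbC. Qed.

Lemma cycle_C5_sym : symmetric cycle_C5.
Proof. by move=> i j; rewrite /cycle_C5 /= orbC. Qed.

Lemma monochrome_path_P3 A c w x y z : symmetric_on col A ->
  uniq [:: w; x; y; z] -> A =i [:: w; x; y; z] ->
  col w x = c -> col x y = c -> col y z = c ->
  col w y != c -> col w z != c -> col x z != c ->
  monochrome_iso col A (c, A) path_P3.
Proof.
move=> sym un eA wx xy yz /negPf wy /negPf wz /negPf xz.
apply: (@monochrome_iso_tuple _ _ _ _ [tuple w; x; y; z]) => //.
- exact: path_P3_sym.
- by move=> [[|[|[|[|]]]] ?].
move=> [[|[|[|[|?]]]] ?] [[|[|[|[|?]]]] ?] //= _;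
  by rewrite !(tnth_nth w) /= ?wx ?xy ?yz ?wy ?wz ?xz ?eqxx.
Qed.

Lemma monochrome_cycle_C5 A c v w x y z : symmetric_on col A ->
  uniq [:: v; w; x; y; z] -> A =i [:: v; w; x; y; z] ->
  col v w = c -> col w x = c -> col x y = c -> col y z = c -> col v z = c ->
  col v x != c -> col v y != c -> col w y != c -> col w z != c -> col x z != c ->
  monochrome_iso col A (c, A) cycle_C5.
Proof.
move=> sym un eA vw wx xy yz vz /negPf vx /negPf vy /negPf wy /negPf wz /negPf xz.
apply: (@monochrome_iso_tuple _ _ _ _ [tuple v; w; x; y; z]) => //.
- exact: cycle_C5_sym.
- by move=> [[|[|[|[|[|]]]]] ?].
move=> [[|[|[|[|[|?]]]]] ?] [[|[|[|[|[|?]]]]] ?] //= _;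
  by rewrite !(tnth_nth v) /= ?vw ?wx ?xy ?yz ?vz ?vx ?vy ?wy ?wz ?xz ?eqxx.
Qed.

End Simple.

(** * Cliques with two connected colors *)

Section TwoColors.
Variables (V : finType) (C : eqType) (col : V -> V -> C) (A : {set V}).
Hypothesis symA : symmetric_on col A.
Hypothesis galA : exact_gallai col A.

(** The situation once a third connected color is excluded. It is symmetric in [c] and [d], so
    mirror cases are proved only once. *)
Definition color_pair c d := [/\ c != d, connected_in col A c,
  connected_in col A d &
  {in A &, forall x y, x != y -> col x y = c \/ col x y = d}].

Lemma color_pairC c d : color_pair c d -> color_pair d c.
Proof.
case=> ncd conc cond two; split=> // [|x y xA yA nxy]; first by rewrite eq_sym.
by have [] := two x y xA yA nxy; [right|left].
Qed.

Definition neighbors c v := [set x in A | (v != x) && (col v x == c)].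

Lemma neighborsP c v x : reflect [/\ x \in A, v != x & col v x = c] (x \in neighbors c v).
Proof. by rewrite inE; apply: (iffP and3P) => -[? ? /eqP]. Qed.

Lemma color_pair_or c d x y : color_pair c d -> x \in A -> y \in A -> x != y ->
  col x y != c -> col x y = d.
Proof. by case=> _ _ _ two xA yA /(two x y xA yA)[->|//]; rewrite eqxx. Qed.

Lemma not_both c d x y : color_pair c d -> col x y = d -> col x y != c.
Proof. by case=> ncd _ _ _ ->; rewrite eq_sym. Qed.

(** No two of these neighbors are joined by [c], so three of them would span a triangle of color
    [d]. *)
Lemma card_neighbors c d v : color_pair c d -> v \in A -> #|neighbors c v| <= 2.
Proof.
move=> tcd vA; rewrite leqNgt; apply/negP=> /card_gt2P[x [y [z [[]]]]].
move=> /neighborsP[xA nvx vx] /neighborsP[yA nvy vy] /neighborsP[zA nvz vz] [nxy nyz nzx].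
have nxz : x != z by rewrite eq_sym.
have opp s t : s \in A -> t \in A -> v != s -> v != t -> s != t ->
    col v s = c -> col v t = c -> col s t = d.
  move=> sA tA nvs nvt nst vs vt; apply: (color_pair_or tcd) => //.
  apply/eqP=> st; apply: (no_monochromatic symA galA vA sA tA nvs nst nvt vs st vt).
by apply: (no_monochromatic symA galA xA yA zA nxy nyz nxz); apply: opp.
Qed.

Lemma neighbors_cover c d v : color_pair c d -> v \in A ->
  A = v |: (neighbors c v :|: neighbors d v).
Proof.
case=> _ _ _ two vA; apply/setP=> x; rewrite !inE eq_sym.
have [<-|nvx] /= := eqVneq v x; rewrite // -andb_orr.
case xA: (x \in A) => //=; apply/esym/orP.
by case: (two v x vA xA nvx) => ->; [left|right].
Qed.

(** The triangle [v], [q], [r] forces [c] on [qr], and then [p], [q], [r] forces [d] on [pr]. Color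
    [c] is the path [v], [p], [q], [r], and [d] is the path [q], [v], [r], [p]. *)
Lemma simple_four c d v p q r : color_pair c d ->
  A =i [:: v; p; q; r] -> uniq [:: v; p; q; r] ->
  col v p = c -> col v q = d -> col v r = d -> col p q = c -> simple col A.
Proof.
move=> tcd eA un vp vq vr pq; have tdc := color_pairC tcd.
have cA : #|A| = 4 by rewrite (eq_card eA); apply/card_uniqP.
have [vA pA qA rA] : [/\ v \in A, p \in A, q \in A & r \in A].
  by rewrite !eA !inE !eqxx !orbT.
have := un; rewrite /= !inE !negb_or !andbT -!andbA.
case/and5P=> nvp nvq nvr npq /andP[npr nqr].
have qr : col q r = c.
  apply: (color_pair_or tdc) => //; apply/eqP=> qr.
  exact: (no_monochromatic symA galA vA qA rA nvq nqr nvr vq qr vr).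
have pr : col p r = d.
  apply: (color_pair_or tcd) => //; apply/eqP=> pr.
  exact: (no_monochromatic symA galA pA qA rA npq nqr npr pq qr pr).
have [ncd conc cond _] := tcd.
constructor 2; split=> //; exists (c, A), (d, A); split.
- by rewrite xpair_eqE (negPf ncd).
- by apply: connected_monochrome; rewrite ?cA.
- by apply: connected_monochrome; rewrite ?cA.
- by apply: (monochrome_path_P3 symA un eA) => //; apply: not_both tcd _.
have eA' : A =i [:: q; v; r; p].
  by move=> x; rewrite eA !inE; do 4!case: (x == _).
have s x y : x \in A -> y \in A -> x != y -> col x y = c -> col y x != d.
  by move=> xA yA nxy xy; rewrite symA ?xy // eq_sym.
apply: (monochrome_path_P3 symA _ eA'); rewrite ?vr //.
- by apply/card_uniqP; rewrite -(eq_card eA').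
- by rewrite symA // eq_sym.
- by rewrite symA // eq_sym.
- by rewrite qr.
- exact: s pq.
- by rewrite vp.
Qed.

(** The given edges force all others through triangles: [c] becomes the cycle [v], [p], [r], [s],
    [q], and [d] the cycle [v], [r], [q], [p], [s]. *)
Lemma simple_five c d v p q r s : color_pair c d ->
  A =i [:: v; p; q; r; s] -> uniq [:: v; p; q; r; s] ->
  col v p = c -> col v q = c -> col v r = d -> col v s = d -> col p r = c ->
  simple col A.
Proof.
move=> tcd eA un vp vq vr vs pr; have tdc := color_pairC tcd.
have cA : #|A| = 5 by rewrite (eq_card eA); apply/card_uniqP.
have [[vA pA qA] [rA sA]] : [/\ v \in A, p \in A & q \in A] /\ (r \in A /\ s \in A).
  by rewrite !eA !inE !eqxx !orbT.
have := un; rewrite /= !inE !negb_or !andbT -!andbA.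
case/and5P=> nvp nvq nvr nvs /and5P[npq npr nps nqr /andP[nqs nrs]].
(* Two edges of one color at [x] force the other color on the opposite edge. *)
have third x y z f g : color_pair f g -> x \in A -> y \in A -> z \in A ->
    x != y -> y != z -> x != z -> col x y = f -> col x z = f -> col y z = g.
  move=> tfg xA yA zA nxy nyz nxz xy xz; apply: (color_pair_or tfg) => //.
  by apply/eqP=> yz; apply: (no_monochromatic symA galA xA yA zA nxy nyz nxz xy yz xz).
have sc x y f : x \in A -> y \in A -> x != y -> col x y = f -> col y x = f.
  by move=> xA yA nxy <-; rewrite symA // eq_sym.
have [npv nqv nrv nsv nqp] :
  [/\ p != v, q != v, r != v, s != v & q != p] by rewrite ![_ == v]eq_sym [q == p]eq_sym.
have [nrp nsp nrq nsq nsr] :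
  [/\ r != p, s != p, r != q, s != q & s != r] by rewrite !(eq_sym r) !(eq_sym s) .
have pq : col p q = d by apply: (third v _ _ c).
have rs : col r s = c by apply: (third v _ _ d).
have ps : col p s = d.
  by apply: (third r _ _ c) => //; apply: sc.
have qs : col q s = c.
  by apply: (third p _ _ d).
have rq : col r q = d.
  by apply: (third s _ _ c) => //; apply: sc.
have eA1 : A =i [:: v; p; r; s; q].
  by move=> x; rewrite eA !inE; do 5!case: (x == _).
have eA2 : A =i [:: v; r; q; p; s].
  by move=> x; rewrite eA !inE; do 5!case: (x == _).
have [ncd conc cond _] := tcd.
have nc x y : x \in A -> y \in A -> x != y -> col x y = d -> col y x != c.
  by move=> xA yA nxy xy; rewrite symA ?xy // eq_sym.
have nd x y : x \in A -> y \in A -> x != y -> col x y = c -> col y x != d.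
  by move=> xA yA nxy xy; rewrite symA ?xy // eq_sym.
constructor 3; split=> //; exists (c, A), (d, A); split.
- by rewrite xpair_eqE (negPf ncd).
- by apply: connected_monochrome; rewrite ?cA.
- by apply: connected_monochrome; rewrite ?cA.
- apply: (monochrome_cycle_C5 symA _ eA1) => //; auto.
  by apply/card_uniqP; rewrite -(eq_card eA1).
- apply: (monochrome_cycle_C5 symA _ eA2) => //; auto.
  by apply/card_uniqP; rewrite -(eq_card eA2).
Qed.

Lemma cut_edge c (X : {set V}) x y : connected_in col A c ->
  x \in X -> x \in A -> y \in A -> y \notin X ->
  exists u w, [/\ u \in X, w \in A, w \notin X & col u w = c].
Proof.
move=> conn xX xA yA nyX.
have [u [w [uX nwX]]] := connect_crossing (S := mem X) (conn x y xA yA) xX nyX.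
by rewrite color_edgeE => /and4P[uA wA _ /eqP]; exists u, w.
Qed.

Lemma neighbors1 c v p : neighbors c v = [set p] ->
  [/\ p \in A, v != p & col v p = c].
Proof. by move=> eN; apply/neighborsP; rewrite eN set11. Qed.

Lemma neighbors2 c v p q : neighbors c v = [set p; q] ->
  [/\ p \in A, v != p & col v p = c] /\ [/\ q \in A, v != q & col v q = c].
Proof. by move=> eN; split; apply/neighborsP; rewrite eN !inE eqxx ?orbT. Qed.

(** Only [v], [p], [q] exist. The [d]-neighbor of [p] can only be [q] and the [c]-neighbor of [q]
    can only be [p], so [pq] would have both colors. *)
Lemma color_pair_not_three c d v p q : color_pair c d -> v \in A ->
  neighbors c v = [set p] -> neighbors d v = [set q] -> False.
Proof.
move=> tcd vA eN eM; have [ncd conc cond two] := tcd.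
have [pA nvp vp] := neighbors1 eN; have [qA nvq vq] := neighbors1 eM.
have A1 : 1 < #|A| by apply/card_gt1P; exists v, p.
have memA x : x \in A -> [\/ x = v, x = p | x = q].
  rewrite (neighbors_cover tcd vA) eN eM !inE.
  by case/or3P=> /eqP; [constructor 1|constructor 2|constructor 3].
have npq : p != q by apply: contraNneq ncd => epq; rewrite -vp -vq epq.
have [x [/memA xA npx px]] := connected_neighbor cond A1 pA.
have [y [/memA yA nqy qy]] := connected_neighbor conc A1 qA.
case: xA npx px => [->|->|->]; rewrite ?eqxx // => _ px.
  by move: ncd; rewrite -vp -px symA ?eqxx // eq_sym.
case: yA nqy qy => [->|->|->]; rewrite ?eqxx // => _ qy.
  by move: ncd; rewrite -vq -qy symA ?eqxx // eq_sym.
by move: ncd; rewrite -px -qy symA ?eqxx // eq_sym.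
Qed.

(** Connectedness of [c] gives an edge of color [c] leaving [v] and [p]. It starts at [p], since [v]
    has no other [c]-neighbor, and ends at [q] or [r]; the two cases differ by exchanging these
    names. *)
Lemma color_pair_four c d v p q r : color_pair c d -> v \in A ->
  neighbors c v = [set p] -> neighbors d v = [set q; r] -> q != r -> simple col A.
Proof.
move=> tcd vA eN eM nqr; have [ncd conc cond two] := tcd.
have [pA nvp vp] := neighbors1 eN.
have [[qA nvq vq] [rA nvr vr]] := neighbors2 eM.
have [npq npr] : p != q /\ p != r.
  by split; apply: contraNneq ncd => e; rewrite -vp e ?vq ?vr.
have eA : A =i [:: v; p; q; r].
  by move=> x; rewrite (neighbors_cover tcd vA) eN eM !inE.
have un : uniq [:: v; p; q; r].
  by rewrite /= !inE !negb_or nvp nvq nvr npq npr nqr.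
have [u [w []]] : exists u w,
    [/\ u \in [set v; p], w \in A, w \notin [set v; p] & col u w = c].
  apply: (@cut_edge _ _ v q) => //; first by rewrite !inE eqxx.
  by rewrite !inE negb_or eq_sym nvq eq_sym npq.
rewrite eA !inE => /orP[]/eqP->{u} /or4P[]/eqP->{w}; rewrite ?eqxx ?orbT // => _.
- by move=> vqc; case/eqP: ncd; rewrite -vq.
- by move=> vrc; case/eqP: ncd; rewrite -vr.
- exact: (simple_four tcd eA un).
- apply: (@simple_four c d v p r q) => //.
    by move=> x; rewrite eA !inE; do 4!case: (x == _).
  by rewrite /= !inE !negb_or nvp nvq nvr npq npr eq_sym nqr.
Qed.

(** An edge of color [c] leaving [v], [p], [q] joins [p] or [q] to [r] or [s]. The four cases are
    relabelings of the configuration in [simple_five]. *)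
Lemma color_pair_five c d v p q r s : color_pair c d -> v \in A ->
  neighbors c v = [set p; q] -> p != q ->
  neighbors d v = [set r; s] -> r != s -> simple col A.
Proof.
move=> tcd vA eN npq eM nrs; have [ncd conc cond two] := tcd.
have [[pA nvp vp] [qA nvq vq]] := neighbors2 eN.
have [[rA nvr vr] [sA nvs vs]] := neighbors2 eM.
have dif x y : col v x = c -> col v y = d -> x != y.
  by move=> vx vy; apply: contraNneq ncd => e; rewrite -vx e vy.
have eA : A =i [:: v; p; q; r; s].
  by move=> x; rewrite (neighbors_cover tcd vA) eN eM !inE -!orbA.
have uns x y z t : x \in A -> y \in A -> z \in A -> t \in A -> x != y -> z != t ->
    v != x -> v != y -> v != z -> v != t ->
    col v x = c -> col v y = c -> col v z = d -> col v t = d -> uniq [:: v; x; y; z; t].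
  move=> xA yA zA tA nxy nzt nvx nvy nvz nvt vx vy vz vt.
  by rewrite /= !inE !negb_or nvx nvy nvz nvt nxy nzt !dif.
have [nqp nsr] : q != p /\ s != r by rewrite eq_sym npq eq_sym nrs.
have [u [w []]] : exists u w,
    [/\ u \in [set v; p; q], w \in A, w \notin [set v; p; q] & col u w = c].
  apply: (@cut_edge _ _ v r) => //; first by rewrite !inE eqxx.
  by rewrite !inE !negb_or eq_sym nvr ![r == _]eq_sym !dif.
have perm x y z t : [:: x; y] =i [:: p; q] -> [:: z; t] =i [:: r; s] ->
    A =i [:: v; x; y; z; t].
  move=> exy ezt k; have := exy k; have := ezt k; rewrite eA !inE.
  by case: (k == v) => //=; rewrite !orbA -!(orbA (_ || _)) => -> ->.
have swap (x y : V) : [:: x; y] =i [:: y; x] by move=> k; rewrite !inE orbC.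
rewrite eA !inE -orbA !negb_or -!andbA => /or3P[]/eqP->{u};
  move=> /or4P[/eqP->|/eqP->|/eqP->|/orP[]/eqP->] {w};
  rewrite ?eqxx ?andbF //; move=> _ uw.
- by case/eqP: ncd; rewrite -vr.
- by case/eqP: ncd; rewrite -vs.
- by apply: (@simple_five c d v p q r s) => //; first [exact: uns | exact: perm].
- by apply: (@simple_five c d v p q s r) => //; first [exact: uns | exact: perm].
- by apply: (@simple_five c d v q p r s) => //; first [exact: uns | exact: perm].
- by apply: (@simple_five c d v q p s r) => //; first [exact: uns | exact: perm].
Qed.

(** Any vertex has one or two neighbors in each color. These two degrees fix the number of vertices
    as three, four or five, and three is impossible. *)
Lemma color_pair_simple c d : color_pair c d -> 1 < #|A| -> simple col A.
Proof.
move=> tcd A1; have tdc := color_pairC tcd.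
have [_ conc cond _] := tcd.
have /card_gt0P[v vA] : 0 < #|A| by apply: leq_trans A1.
have nbr f g : color_pair f g -> connected_in col A f ->
    (exists p, neighbors f v = [set p]) \/
    (exists p q, p != q /\ neighbors f v = [set p; q]).
  move=> tfg conf; have [x [xA nvx vx]] := connected_neighbor conf A1 vA.
  have : 0 < #|neighbors f v| by apply/card_gt0P; exists x; apply/neighborsP.
  case cN: #|_| (card_neighbors tfg vA) => [|[|[|n]]] // _ _.
    by left; apply/cards1P/eqP.
  have /cards2P[p [q [npq eN]]] : #|neighbors f v| == 2 by rewrite cN.
  by right; exists p, q.
have [[p eN]|[p [q [npq eN]]]] := nbr c d tcd conc;
  have [[r eM]|[r [s [nrs eM]]]] := nbr d c tdc cond.
- by case: (color_pair_not_three tcd vA eN eM).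
- exact: color_pair_four tcd vA eN eM nrs.
- exact: color_pair_four tdc vA eM eN npq.
- exact: color_pair_five tcd vA eN npq eM nrs.
Qed.

End TwoColors.

(** * Irreducible exact Gallai cliques are simple *)

Section IrreducibleSimple.
Variables (V : finType) (C : eqType) (col : V -> V -> C).
Implicit Types (A B : {set V}) (c d : C).

Theorem irreducible_simple A : symmetric_on col A -> exact_gallai col A ->
  irreducible col A -> 1 < #|A| -> simple col A.
Proof.
move=> sym gal irr A1; have conn := irreducible_connected sym gal irr.
have [A2|A2] := leqP #|A| 2; first by constructor 1; apply/eqP; rewrite eqn_leq A2.
have /card_gt2P[x [y [z [[xA yA zA] [nxy nyz nzx]]]]] := A2.
have nxz : x != z by rewrite eq_sym.
have used u v : u \in A -> v \in A -> u != v -> col u v \in edge_colors col A.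
  by move=> uA vA nuv; apply/edge_colorsP; exists u, v.
(* A triangle is not monochromatic, so it supplies two distinct colors. *)
have [c [d [cA dA ncd]]] : exists c d,
    [/\ c \in edge_colors col A, d \in edge_colors col A & c != d].
  have [exy|nexy] := eqVneq (col x y) (col y z).
    exists (col x y), (col x z); split; rewrite ?used //; apply/eqP=> e.
    exact: (no_monochromatic sym gal xA yA zA nxy nyz nxz erefl (esym exy) (esym e)).
  by exists (col x y), (col y z); split; rewrite ?used.
apply: (@color_pair_simple _ _ _ _ sym gal c d) => //.
split=> //; [exact: conn|exact: conn|] => u v uA vA nuv.
have [ec|nec] := eqVneq (col u v) c; first by left.
have [ed|ned] := eqVneq (col u v) d; first by right.
exfalso; apply: (@not_three_connected _ _ col A (col u v) c d) => //; apply: conn => //.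
exact: used.
Qed.

End IrreducibleSimple.

(** * Properties of simple cliques *)

Section SimpleConsequences.
Variables (V : finType) (C : eqType) (col : V -> V -> C).
Implicit Types (A B : {set V}) (c d : C).

(** The component lies inside [A], and the isomorphism gives it as many vertices as [A] has. *)
Lemma monochrome_iso_full A c (M : {set V}) n (H : rel 'I_n) :
  #|A| = n -> monochrome col A (c, M) -> monochrome_iso col A (c, M) H -> M = A.
Proof.
move=> cA [x [y [xy eM]]] [f [injf eMf _]]; rewrite /= in xy eM eMf.
apply/eqP; rewrite eqEcard; apply/andP; split.
  apply/subsetP=> z; rewrite eM inE => xz; apply: contraT => nzA.
  have xA : x \in mem A by case/and4P: xy.
  have [u [w [_ /negP nw]]] := connect_crossing (S := mem A) xz xA nzA.
  by rewrite color_edgeE => /and4P[_ wA].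
by rewrite -eMf card_imset // cardsT card_ord cA.
Qed.

(** Ordered pairs count each edge twice, to be compared with the [n * n - n] ordered pairs of
    distinct vertices. *)
Definition edge_set A c : {set V * V} := [set p | color_edge col A c p.1 p.2].

Lemma card_edge_set A c n (H : rel 'I_n) : monochrome_iso col A (c, A) H ->
  #|edge_set A c| = #|[set p : 'I_n * 'I_n | H p.1 p.2]|.
Proof.
case=> f [injf /= eA eH]; pose g p := (f p.1, f p.2).
have injg : injective g by move=> [i j] [k l] [/injf-> /injf->].
rewrite -(card_imset _ injg); congr #|pred_of_set _|; apply/setP=> -[x y].
rewrite inE /=; apply/idP/imsetP=> [xy|[[i j] + [-> ->]]]; last by rewrite inE eH.
have [xA yA] : x \in A /\ y \in A by case/and4P: (xy).
move: xA yA; rewrite -eA => /imsetP[i _ ex] /imsetP[j _ ey].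
by exists (i, j); rewrite ?inE /= -?eH -?ex -?ey // /g /= -ex -ey.
Qed.

(** [H] has half of the edges of the complete graph on [n] vertices. Two copies in different colors
    are disjoint, so they exhaust all edges and leave no room for a third color. *)
Lemma two_monochromes_colors A n (H : rel 'I_n) :
  #|A| = n -> 2 * #|[set p : 'I_n * 'I_n | H p.1 p.2]| = n * n - n ->
  two_monochromes_iso col A H ->
  exists c d, [/\ c != d, monochrome_iso col A (c, A) H,
    monochrome_iso col A (d, A) H
    & {in A &, forall x y, x != y -> col x y = c \/ col x y = d}].
Proof.
move=> cA cH [[c M1] [[d M2] [nm mon1 mon2 iso1 iso2]]].
have eM1 := monochrome_iso_full cA mon1 iso1.
have eM2 := monochrome_iso_full cA mon2 iso2; subst M1 M2.
have ncd : c != d by apply: contraNneq nm => ->.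
exists c, d; split=> // x y xA yA nxy.
pose D := [set p in setX A A | p.1 != p.2].
have cD : #|D| = n * n - n.
  have diagE : [set p in setX A A | p.1 == p.2] = [set (x, x) | x in A].
    apply/setP=> -[u w]; rewrite !inE /=; apply/idP/imsetP.
      by case/andP=> /andP[uA _] /eqP<-; exists u.
    by case=> z zA [-> ->]; rewrite zA eqxx.
  have cdiag : #|[set p in setX A A | p.1 == p.2]| = n.
    by rewrite diagE card_imset // => u w [].
  have := cardsID [set p | p.1 == p.2] (setX A A); rewrite cardsX cA => <-.
  have -> : setX A A :&: [set p | p.1 == p.2] = [set p in setX A A | p.1 == p.2].
    by apply/setP=> p; rewrite !inE.
  rewrite cdiag addKn; congr #|pred_of_set _|.
  by apply/setP=> p; rewrite !inE andbC.
have eD : edge_set A c :|: edge_set A d = D.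
  apply/eqP; rewrite eqEcard; apply/andP; split.
    by apply/subsetP=> -[u w]; rewrite !inE /= => /orP[]/and4P[-> -> -> _].
  rewrite cardsU disjoint_setI0 ?cards0 ?subn0; last first.
    apply/pred0P=> -[u w] /=; rewrite !inE /=; apply/negP.
    by case/andP=> /and4P[_ _ _ /eqP uwc] /and4P[_ _ _]; rewrite [col _ _]uwc (negPf ncd).
  by rewrite (card_edge_set iso1) (card_edge_set iso2) addnn -mul2n cH cD.
have : (x, y) \in edge_set A c :|: edge_set A d by rewrite eD !inE /= xA yA nxy.
by rewrite !inE /= => /orP[]/and4P[_ _ _ /eqP]; [left|right].
Qed.

(** Since [H] has no triangle, neither color has one, so each triangle shows both colors. Since [H]
    has no isolated vertex, every vertex meets both colors. *)
Lemma two_monochromes_spec A n (H : rel 'I_n) :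
  #|A| = n -> 2 * #|[set p : 'I_n * 'I_n | H p.1 p.2]| = n * n - n ->
  (forall i j k, ~~ [&& H i j, H j k & H i k]) -> (forall i, exists j, H i j) ->
  symmetric_on col A -> two_monochromes_iso col A H ->
  [/\ exact_gallai col A, size (edge_colors col A) <= 2
    & forall c x, c \in edge_colors col A -> x \in A ->
        exists y, [/\ y \in A, x != y & col x y = c]].
Proof.
move=> cA cH noH3 noH0 sym /(two_monochromes_colors cA cH)[c [d [ncd isoc isod two]]].
have tri f x y z : monochrome_iso col A (f, A) H -> x \in A -> y \in A -> z \in A ->
    x != y -> y != z -> x != z -> col x y = f -> col y z = f -> col x z <> f.
  move=> [g [injg /= eA eH]] xA yA zA nxy nyz nxz xy yz xz.
  have := (xA, yA, zA); rewrite -eA.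
  move=> -[[]] /imsetP[i _ ei] /imsetP[j _ ej] /imsetP[k _ ek].
  have := noH3 i j k; rewrite -!eH -ei -ej -ek !color_edgeE xA yA zA nxy nyz nxz.
  by rewrite xy yz xz eqxx.
split.
- apply/exact_gallaiP=> // x y z xA yA zA nxy nyz nxz.
  have tc := tri c x y z isoc xA yA zA nxy nyz nxz.
  have td := tri d x y z isod xA yA zA nxy nyz nxz.
  have [[xy yz] xz] := (two x y xA yA nxy, two y z yA zA nyz, two x z xA zA nxz).
  have ndc : d != c by rewrite eq_sym.
  rewrite /two_colored; case: xy tc td => -> tc td; case: yz tc td => -> tc td;
    case: xz tc td => -> tc td; rewrite ?eqxx ?(negPf ncd) ?(negPf ndc) //.
    by case: tc.
  by case: td.
- apply: (@leq_trans (size [:: c; d])) => //; apply: uniq_leq_size.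
    exact: undup_uniq.
  move=> f /edge_colorsP[x [y [xA yA nxy <-]]]; rewrite !inE.
  by case: (two x y xA yA nxy) => ->; rewrite eqxx ?orbT.
move=> f x /edge_colorsP[u [w [uA wA nuw <-]]] xA.
have look g : monochrome_iso col A (g, A) H ->
    exists y, [/\ y \in A, x != y & col x y = g].
  case=> h [injh /= eA eH]; move: (xA); rewrite -{1}eA => /imsetP[i _ ei].
  have [j Hij] := noH0 i; exists (h j).
  by move: Hij; rewrite -eH color_edgeE -ei => /and4P[_ -> -> /eqP].
by case: (two u w uA wA nuw) => ->; apply: look.
Qed.

Lemma card_path_P3 : #|[set p : 'I_4 * 'I_4 | path_P3 p.1 p.2]| = 6.
Proof.
rewrite -sum1dep_card big_mkcond /=.
rewrite -(pair_bigA _ (fun i j => if path_P3 i j then 1 else 0)) /=.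
by rewrite !big_ord_recl !big_ord0.
Qed.

Lemma card_cycle_C5 : #|[set p : 'I_5 * 'I_5 | cycle_C5 p.1 p.2]| = 10.
Proof.
rewrite -sum1dep_card big_mkcond /=.
rewrite -(pair_bigA _ (fun i j => if cycle_C5 i j then 1 else 0)) /=.
by rewrite !big_ord_recl !big_ord0.
Qed.

(** These are the only properties of simple factors on which the tree arguments rely. For the path
    and the cycle they reduce to finite checks on the two graphs. *)
Lemma simple_spec A : symmetric_on col A -> simple col A ->
  [/\ exact_gallai col A, size (edge_colors col A) <= 2
    & forall c x, c \in edge_colors col A -> x \in A ->
        exists y, [/\ y \in A, x != y & col x y = c]].
Proof.
move=> sym [cA|[cA iso]|[cA iso]].
- have /cards2P[u [w [nuw eA]]] : #|A| == 2 by rewrite cA.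
  have uA : u \in A by rewrite eA !inE eqxx.
  have wA : w \in A by rewrite eA !inE eqxx orbT.
  have two x y : x \in A -> y \in A -> x != y -> col x y = col u w.
    rewrite eA !inE => /orP[]/eqP-> /orP[]/eqP->; rewrite ?eqxx // => _.
    by rewrite sym // eq_sym.
  have mono c : c \in edge_colors col A -> c = col u w.
    by case/edge_colorsP=> x [y [xA yA nxy <-]]; apply: two.
  split.
  + by move=> B /subset_leq_card; rewrite cA => + cB; rewrite cB.
  + apply: (@leq_trans (size [:: col u w])) => //; apply: uniq_leq_size.
      exact: undup_uniq.
    by move=> c /mono->; rewrite inE.
  + move=> c x /mono-> xA; move: (xA); rewrite {1}eA !inE => /orP[]/eqP->.
      by exists w.
    by exists u; split; rewrite // ?two // eq_sym.
- apply: (two_monochromes_spec cA _ _ _ sym iso); first by rewrite card_path_P3.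
    by move=> [[|[|[|[|?]]]] ?] [[|[|[|[|?]]]] ?] [[|[|[|[|?]]]] ?].
  move=> [[|[|[|[|?]]]] ?] //.
  (* Neighbors along the path: 0, 1 and 2 step forward, while the end 3 steps back to 2. *)
  + by exists (inord 1); rewrite /path_P3 /= !inordK.
  + by exists (inord 2); rewrite /path_P3 /= !inordK.
  + by exists (inord 3); rewrite /path_P3 /= !inordK.
  + by exists (inord 2); rewrite /path_P3 /= !inordK.
- apply: (two_monochromes_spec cA _ _ _ sym iso); first by rewrite card_cycle_C5.
    by move=> [[|[|[|[|[|?]]]]] ?] [[|[|[|[|[|?]]]]] ?] [[|[|[|[|[|?]]]]] ?].
  move=> i; exists (inord (i.+1 %% 5)).
  by rewrite /cycle_C5 /= inordK ?ltn_mod // modn_mod eqxx.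
Qed.

End SimpleConsequences.

(** * Colored trees *)

Section TreeColorings.
Variables (d : Order.disp_t) (T : finPOrderType d) (C : eqType) (hat : T -> T -> C).
Hypothesis treeT : is_tree T.
Hypothesis hat_sym : edge_coloring (@sibling d T) hat.
Implicit Types (p q s t u v w x y z : T).
Local Open Scope order_scope.

Lemma children_incomparable p u v :
  u \in children p -> v \in children p -> u != v -> u >< v.
Proof.
move=> up vp nuv; apply/negP=> uv.
have no s t : s \in children p -> t \in children p -> ~~ (s < t).
  move=> sp tp; apply/negP=> st; move: (sp); rewrite inE => /andP[_ /existsPn/(_ t)].
  by rewrite st child_lt.
move: uv nuv (no _ _ up vp) (no _ _ vp up); rewrite /Order.comparable !le_eqVlt.
by rewrite [v == u]eq_sym => /orP[]/orP[->|->].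
Qed.

Lemma children_sibling p u v :
  u \in children p -> v \in children p -> u != v -> sibling u v.
Proof.
move=> up vp nuv; rewrite /sibling /= (children_incomparable up vp nuv).
by apply/existsP; exists p; rewrite up.
Qed.

Lemma children_uniq p u v s :
  u \in children p -> v \in children p -> s <= u -> s <= v -> u = v.
Proof.
move=> up vp su sv; apply/eqP; apply: contraT => nuv.
by case/negP: (children_incomparable up vp nuv); apply: tree_chain treeT _ _ _ su sv.
Qed.

Lemma hat_symmetric_on p : symmetric_on hat (children p).
Proof. by move=> u v up vp nuv; apply/hat_sym/(children_sibling up vp nuv). Qed.

Lemma children_nonleaf p u : u \in children p -> ~~ leaf p.
Proof. by move=> up; apply/set0Pn; exists u. Qed.

(** The elements above [x] form a chain, and nothing lies strictly between [u] and [q]. *)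
Lemma le_child q u x y : x <= y -> x <= u ->
  u \in children q -> y < q -> y <= u.
Proof.
move=> xy xu uq yq; have /orP[//|uy] := tree_chain treeT xy xu.
move: uy; rewrite le_eqVlt => /predU1P[->//|uy].
by move: uq; rewrite inE => /andP[_ /existsPn/(_ y)]; rewrite uy yq.
Qed.

Hypothesis simpleT : forall t, ~~ leaf t -> simple hat (children t).
Hypothesis colorsT : forall t1 t2, ~~ leaf t1 -> ~~ leaf t2 -> t1 < t2 ->
  forall c, ~~ ((c \in edge_colors hat (children t1))
             && (c \in edge_colors hat (children t2))).

Lemma hat_neq p q u v u' v' : p < q ->
  u \in children p -> v \in children p -> u != v ->
  u' \in children q -> v' \in children q -> u' != v' -> hat u v != hat u' v'.
Proof.
move=> pq up vp nuv uq vq nuv'; apply/eqP=> e.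
have /negP[] := colorsT (children_nonleaf up) (children_nonleaf uq) pq (hat u v).
by apply/andP; split; apply/edge_colorsP; [exists u, v|rewrite e; exists u', v'].
Qed.

(** Let [x] separate from [y] at [p] and from [z] at [q]. If [p < q], then [x] and [y] lie below one
    child of [q], so [xz] and [yz] share a color of the factor at [q], while [xy] has one of the
    factor at [p]. The case [q < p] is similar. If [p = q], either the three leaves lie below
    distinct children, giving a triangle of a simple factor, or [y] and [z] separate strictly
    lower. *)
Lemma leaf_color_two_colored x y z : leaf x -> leaf y -> leaf z ->
  x != y -> y != z -> x != z ->
  two_colored (leaf_color hat x y) (leaf_color hat y z) (leaf_color hat x z).
Proof.
move=> lx ly lz nxy nyz nxz.
have sibE s t : sibling s t ->
    exists p, [/\ s \in children p, t \in children p & s != t].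
  case/andP=> st /existsP[p /andP[sp tp]]; exists p; split=> //.
  by apply: contraNneq st => ->; rewrite /Order.comparable lexx.
have [u [v [sib_uv xu yv ->]]] := leaf_color_spec treeT hat lx ly nxy.
have [u' [v' [sib_uv' xu' zv' ->]]] := leaf_color_spec treeT hat lx lz nxz.
have [p [up vp nuv]] := sibE _ _ sib_uv.
have [q [uq vq nuv']] := sibE _ _ sib_uv'.
have [[ltu ltv] ltu'] := (child_lt up, child_lt vp, child_lt uq).
have pq := tree_chain treeT (le_trans xu (ltW (child_lt up)))
                      (le_trans xu' (ltW (child_lt uq))).
case: (comparableP p q) pq => // [pq|qp|epq] _.
- have pu' : p <= u' by apply: le_child xu' uq pq; apply: le_trans xu (ltW ltu).
  have yu' : y <= u' by apply: le_trans pu'; apply: le_trans yv (ltW (child_lt vp)).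
  rewrite (leaf_colorE treeT hat sib_uv' yu' zv').
  by rewrite /two_colored (negPf (hat_neq pq up vp nuv uq vq nuv')) eqxx.
- have qu : q <= u by apply: le_child xu up qp; apply: le_trans xu' (ltW ltu').
  have zu : z <= u by apply: le_trans qu; apply: le_trans zv' (ltW (child_lt vq)).
  have sib_vu : sibling v u by apply: (children_sibling vp up); rewrite eq_sym.
  rewrite (leaf_colorE treeT hat sib_vu yv zu) (hat_sym sib_vu) /two_colored eqxx.
  by rewrite [hat u v == _]eq_sym (negPf (hat_neq qp uq vq nuv' up vp nuv)).
subst q; have eu := children_uniq up uq xu xu'; subst u'.
have [ev|nv] := eqVneq v v'; last first.
  have sib_vv := children_sibling vp vq nv.
  rewrite (leaf_colorE treeT hat sib_vv yv zv').
  have sym := @hat_symmetric_on p.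
  have [gal _ _] := simple_spec sym (simpleT (children_nonleaf up)).
  by apply: (exact_gallaiP sym).1 gal _ _ _ up vp vq nuv nv nuv'.
subst v'; have [u1 [v1 [sib1 yu1 zv1 ->]]] := leaf_color_spec treeT hat ly lz nyz.
have [r [u1r v1r nuv1]] := sibE _ _ sib1.
(* Both [u1] and [v] lie above [y]. If [v <= u1], then [z] would lie below both siblings [u1] and
   [v1]; so [u1 < v], which puts the parent [r] at or below [v]. *)
have rp : r < p.
  apply: le_lt_trans ltv.
  have [yr yp] := (le_trans yu1 (ltW (child_lt u1r)), le_trans yv (ltW (child_lt vp))).
  have /orP[u1v|vu1] := tree_chain treeT yu1 yv; last first.
    case/andP: sib1 => /negP[]; apply: (tree_chain treeT (s := z)) zv1.
    exact: le_trans zv' vu1.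
  move: u1v; rewrite le_eqVlt => /predU1P[e|u1v].
    case/andP: sib1 => /negP[]; apply: (tree_chain treeT (s := z)) zv1.
    by rewrite e.
  by apply: child_above u1r u1v _; apply: tree_chain yr yv.
rewrite /two_colored eqxx [hat u v == _]eq_sym.
by rewrite (negPf (hat_neq rp u1r v1r nuv1 up vp nuv)).
Qed.

End TreeColorings.

(** * The decomposition tree *)

Section CoarsestPartition.
Variables (V : finType) (C : eqType) (col : V -> V -> C).
Implicit Types (A B D : {set V}) (P : {set {set V}}).

(** A boolean form is needed to minimize over partitions. *)
Definition homogeneousb P : bool :=
  [forall B1 in P, forall B2 in P, (B1 != B2) ==>
     [forall x1 in B1, forall y1 in B1, forall x2 in B2, forall y2 in B2,
        col x1 x2 == col y1 y2]].

Lemma homogeneousP P : reflect (homogeneous col P) (homogeneousb P).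
Proof.
apply: (iffP forall_inP) => [hom B1 B2 B1P B2P nB x1 y1 x2 y2 x1B y1B x2B y2B|hom B1 B1P].
  have /forall_inP/(_ B2 B2P)/implyP/(_ nB) := hom B1 B1P.
  move=> /forall_inP/(_ x1 x1B)/forall_inP/(_ y1 y1B).
  by move=> /forall_inP/(_ x2 x2B)/forall_inP/(_ y2 y2B)/eqP.
apply/forall_inP=> B2 B2P; apply/implyP=> nB.
apply/forall_inP=> x1 x1B; apply/forall_inP=> y1 y1B.
apply/forall_inP=> x2 x2B; apply/forall_inP=> y2 y2B; apply/eqP.
exact: (hom B1 B2).
Qed.

(** Unlike [nontrivial], this admits the partition into singletons, so every set with at least two
    vertices decomposes. *)
Definition decomposes P B := [&& partition P B, homogeneousb P & 1 < #|P|].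

Definition singletons B : {set {set V}} := [set [set x] | x in B].

Lemma singletons_decompose B : 1 < #|B| -> decomposes (singletons B) B.
Proof.
move=> B1; apply/and3P; split; last by rewrite card_imset //; apply: set1_inj.
  apply/and3P; split.
  - apply/eqP/setP=> x; apply/bigcupP/idP=> [[D /imsetP[y yB ->]]|xB].
      by rewrite inE => /eqP->.
    by exists [set x]; rewrite ?set11 // imset_f.
  - apply/trivIsetP=> D1 D2 /imsetP[x _ ->] /imsetP[y _ ->] nxy.
    by rewrite disjoints1 inE; apply: contraNneq nxy => ->.
  - by apply/imsetP=> -[x _ /setP/(_ x)]; rewrite !inE eqxx.
apply/homogeneousP=> D1 D2 /imsetP[x _ ->] /imsetP[y _ ->] _ x1 y1 x2 y2.
by rewrite !inE => /eqP-> /eqP-> /eqP-> /eqP->.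
Qed.

(* Opaque: unfolding the minimization makes unification diverge. *)
Fact coarsest_exists B : {P : {set {set V}} | 1 < #|B| ->
  decomposes P B /\ (forall Q, decomposes Q B -> #|P| <= #|Q|)}.
Proof.
exists [arg min_(P < singletons B | decomposes P B) #|P|].
by move=> /singletons_decompose dec; case: arg_minnP.
Qed.

Definition coarsest B : {set {set V}} := sval (coarsest_exists B).

Lemma coarsestP B : 1 < #|B| -> decomposes (coarsest B) B /\
  (forall P, decomposes P B -> #|coarsest B| <= #|P|).
Proof. exact: svalP (coarsest_exists B). Qed.

(** The size condition excludes sets where [coarsest] carries no information, and makes splitting
    stop at single vertices. *)
Definition block_of : rel {set V} :=
  [rel B D : {set V} | (1 < #|B|) && (D \in coarsest B)].

Lemma block_of_uniq B D1 D2 x :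
  block_of B D1 -> block_of B D2 -> x \in D1 -> x \in D2 -> D1 = D2.
Proof.
move=> /andP[B1 D1B] /andP[_ D2B] xD1 xD2.
have [/and3P[/and3P[_ triv _] _ _] _] := coarsestP B1.
by rewrite -(def_pblock triv D1B xD1) (def_pblock triv D2B xD2).
Qed.

Lemma block_of_cover B x : 1 < #|B| -> x \in B -> exists2 D, block_of B D & x \in D.
Proof.
move=> B1; have [/and3P[/and3P[/eqP cov _ _] _ _] _] := coarsestP B1.
by rewrite -{1}cov => /bigcupP[D DB xD]; exists D; rewrite // /block_of /= B1.
Qed.

Lemma block_of_neq0 B D : block_of B D -> D != set0.
Proof.
case/andP=> B1 DB; have [/and3P[/and3P[_ _ n0] _ _] _] := coarsestP B1.
by apply: contraNneq n0 => <-.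
Qed.

Lemma block_of_proper B D : block_of B D -> D \proper B.
Proof.
move=> bBD; have /andP[B1 DB] := bBD.
have [/and3P[/and3P[/eqP cov triv n0] _ P1] _] := coarsestP B1.
have /card_gt1P[E1 [E2 [E1B E2B nE]]] := P1.
have sub E : E \in coarsest B -> E \subset B by move=> EB; rewrite -cov (bigcup_max E).
have [E EB nED] : exists2 E, E \in coarsest B & E != D.
  by have [e|?] := eqVneq E1 D; [exists E2; rewrite // -e eq_sym|exists E1].
have /set0Pn[x xE] : E != set0 by apply: contraNneq n0 => <-.
apply/properP; split; first exact: sub.
exists x; first exact: subsetP (sub E EB) x xE.
apply: contra nED => xD; apply/eqP.
by apply: (@block_of_uniq B E D x) => //; rewrite /block_of /= B1.
Qed.

Lemma connect_block_ind B D : connect block_of B D ->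
  D = B \/ exists2 E, block_of B E & connect block_of E D.
Proof.
case/connectP=> -[|E p] /=; first by left.
by case/andP=> BE pE ->; right; exists E => //; apply/connectP; exists p.
Qed.

Lemma connect_block_sub B D : connect block_of B D -> D \subset B.
Proof.
case/connectP=> p + ->; elim: p B => [|E p IHp] B //= /andP[BE pE].
exact: subset_trans (IHp _ pE) (proper_sub (block_of_proper BE)).
Qed.

Lemma connect_block_neq0 B D : B != set0 -> connect block_of B D -> D != set0.
Proof.
move=> + /connectP[p + ->]; elim: p B => [|E p IHp] B //= nB /andP[BE pE].
exact: IHp (block_of_neq0 BE) pE.
Qed.

(** Both descents from [A] keep [x], so they enter the same block at each step until one of them
    stops. *)
Lemma connect_block_laminar A B D x :
  connect block_of A B -> connect block_of A D -> x \in B -> x \in D ->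
  connect block_of B D \/ connect block_of D B.
Proof.
have [n] := ubnP #|A|; elim: n A => // n IHn A; rewrite ltnS => le_n AB AD xB xD.
have [eB|[E1 AE1 E1B]] := connect_block_ind AB; first by left; rewrite eB.
have [eD|[E2 AE2 E2D]] := connect_block_ind AD; first by right; rewrite eD.
have eE : E1 = E2.
  by apply: block_of_uniq AE1 AE2 (subsetP (connect_block_sub E1B) x xB)
    (subsetP (connect_block_sub E2D) x xD).
subst E2; apply: (IHn E1) => //.
exact: leq_trans (proper_card (block_of_proper AE1)) le_n.
Qed.

(** The blocks containing [x] shrink strictly until only [x] remains. *)
Lemma connect_block_set1 B x : x \in B -> connect block_of B [set x].
Proof.
have [n] := ubnP #|B|; elim: n B => // n IHn B; rewrite ltnS => le_n xB.
have [B1|B1] := leqP #|B| 1.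
  suff -> : B = [set x] by apply: connect0.
  apply/eqP; rewrite eq_sym eqEcard sub1set xB cards1; exact: B1.
have [D BD xD] := block_of_cover B1 xB.
apply: connect_trans (connect1 BD) (IHn D _ xD).
exact: leq_trans (proper_card (block_of_proper BD)) le_n.
Qed.

End CoarsestPartition.

(** * The tree of iterated blocks, ordered by inclusion *)

Section DecompositionTree.
Variables (V : finType) (C : eqType) (col : V -> V -> C) (A : {set V}).

Definition node := {B : {set V} | connect (block_of col) A B}.

HB.instance Definition _ := Finite.on node.
HB.instance Definition _ := SubChoice.on node.

Implicit Types p s t u v w : node.

Definition node_le s t := val s \subset val t.

Fact node_le_refl : reflexive node_le.
Proof. by move=> s; apply: subxx. Qed.

Fact node_le_anti : antisymmetric node_le.
Proof. by move=> s t; rewrite -eqEsubset => /eqP/val_inj. Qed.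

Fact node_le_trans : transitive node_le.
Proof. by move=> t s u; apply: subset_trans. Qed.

Fact node_display : Order.disp_t. Proof. exact: Order.Disp tt tt. Qed.

HB.instance Definition _ := Order.Le_isPOrder.Build node_display node
  node_le_refl node_le_anti node_le_trans.

Lemma node_leE s t : (s <= t)%O = (val s \subset val t).
Proof. by []. Qed.

Lemma node_ltE s t : (s < t)%O = (val s \proper val t).
Proof. by rewrite lt_neqAle node_leE properEneq. Qed.

Definition node_sub s B (sB : block_of col (val s) B) : node :=
  Sub B (connect_trans (valP s) (connect1 sB)).

Hypothesis A0 : A != set0.

Lemma node_neq0 s : val s != set0.
Proof. exact: connect_block_neq0 A0 (valP s). Qed.

Lemma node_laminar s t x : x \in val s -> x \in val t -> (s >=< t)%O.
Proof.
move=> xs xt; have [st|ts] := connect_block_laminar (valP s) (valP t) xs xt.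
  by apply/orP; right; apply: connect_block_sub st.
by apply/orP; left; apply: connect_block_sub ts.
Qed.

Lemma node_tree : is_tree node.
Proof.
move=> s t nst; split.
  exists (Sub A (connect0 _ _)); rewrite !node_leE /=.
  by split; apply: connect_block_sub; apply: valP.
case=> u [us ut]; have /set0Pn[x xu] := node_neq0 u.
case/negP: nst; apply: (@node_laminar _ _ x); first exact: (subsetP us).
exact: (subsetP ut).
Qed.

Lemma lt_block s t : (s < t)%O -> exists2 B, block_of col (val t) B & val s \subset B.
Proof.
rewrite node_ltE => pst; have /set0Pn[x xs] := node_neq0 s.
have xt := subsetP (proper_sub pst) x xs.
have [st|ts] := connect_block_laminar (valP s) (valP t) xs xt.
  by move: pst; rewrite properE (connect_block_sub st) andbF.
have [e|[B tB Bs]] := connect_block_ind ts; first by rewrite e properxx in pst.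
by exists B; last exact: connect_block_sub Bs.
Qed.

(** Any node strictly inside [t] lies in a block of [t], and that block is itself a node. Hence
    covering is exactly one splitting step. *)
Lemma childrenE s t : (s \in children t) = block_of col (val t) (val s).
Proof.
rewrite inE; apply/andP/idP => [[st nb]|ts].
  have [B tB sB] := lt_block st.
  have [->//|nsB] := eqVneq (val s) B.
  case/existsP: nb; exists (node_sub tB); rewrite !node_ltE /= (block_of_proper tB).
  by rewrite properEneq nsB sB.
split; first by rewrite node_ltE (block_of_proper ts).
apply/existsPn=> u; apply/negP=> /andP[su /lt_block[B tB uB]].
have /set0Pn[x xs] := node_neq0 s.
have e : val s = B.
  apply: (block_of_uniq ts tB xs); apply: (subsetP uB).
  by have /subsetP := ltW su; apply.
by move: su; rewrite node_ltE properE e uB andbF.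
Qed.

Lemma leafE t : leaf t = (#|val t| <= 1).
Proof.
have [t1|t1] := leqP #|val t| 1.
  by apply/eqP/setP=> s; rewrite childrenE in_set0 /block_of /= ltnNge t1.
have [x xt] : exists x, x \in val t by apply/card_gt0P; apply: leq_trans t1.
have [B tB _] := block_of_cover col t1 xt.
by apply/negbTE/set0Pn; exists (node_sub tB); rewrite childrenE.
Qed.

Hypothesis symA : symmetric_on col A.
Variable x0 : V.

(** The default [x0] makes the choice total; [mem_rep] shows that nodes, being nonempty, yield a
    vertex of their own. *)
Definition rep t : V := odflt x0 [pick x in val t].
(** Between distinct siblings, homogeneity makes the value independent of the representatives, as
    [hatE] states. *)
Definition hat s t : C := col (rep s) (rep t).

Lemma mem_rep t : rep t \in val t.
Proof.
rewrite /rep; case: pickP => [//|nt].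
by have /set0Pn[x] := node_neq0 t; have := nt x => /= ->.
Qed.

Lemma node_subset s : val s \subset A.
Proof. exact: connect_block_sub (valP s). Qed.

Lemma children_disjoint p s t x :
  s \in children p -> t \in children p -> x \in val s -> x \in val t -> s = t.
Proof.
by rewrite !childrenE => sp tp xs xt; apply/val_inj/(block_of_uniq sp tp xs xt).
Qed.

Lemma hatE p s t x y : s \in children p -> t \in children p -> s != t ->
  x \in val s -> y \in val t -> col x y = hat s t.
Proof.
rewrite !childrenE => /andP[p1 sp] /andP[_ tp] nst xs yt.
have [/and3P[_ /homogeneousP hom _] _] := coarsestP col p1.
by apply: (hom (val s) (val t)) => //; apply: mem_rep.
Qed.

Lemma rep_neq p s t : s \in children p -> t \in children p -> s != t -> rep s != rep t.
Proof.
move=> sp tp; apply: contraNneq => e; apply/eqP.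
by apply: (children_disjoint sp tp (mem_rep s)); rewrite e mem_rep.
Qed.

Lemma mem_rep_root t : rep t \in A.
Proof. exact: subsetP (node_subset t) _ (mem_rep t). Qed.

Lemma hat_sibling_sym : edge_coloring (@sibling _ node) hat.
Proof.
move=> s t /andP[nst /existsP[p /andP[sp tp]]]; apply: symA; rewrite ?mem_rep_root //.
by apply: (rep_neq sp tp); apply: contraNneq nst => ->; apply: comparablexx.
Qed.

Lemma leaf_color_node x y s t : leaf s -> leaf t -> val s = [set x] -> val t = [set y] ->
  x != y -> leaf_color hat s t = col x y.
Proof.
move=> ls lt es et nxy; have nst : s != t.
  apply: contraNneq nxy => est; move: et; rewrite -est es => /set1_inj->.
  exact: eqxx.
have [u [v [/andP[nuv /existsP[p /andP[up vp]]] su tv ->]]] :=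
  leaf_color_spec node_tree hat ls lt nst.
apply/esym/(hatE up vp); first by apply: contraNneq nuv => ->; apply: comparablexx.
  by apply: (subsetP su); rewrite es set11.
by apply: (subsetP tv); rewrite et set11.
Qed.

Hypothesis galA : exact_gallai col A.

(** Representatives of distinct children are distinct vertices of [A], so a triangle of the factor
    is a triangle of [A]. *)
Lemma children_exact_gallai p : exact_gallai hat (children p).
Proof.
have sym := hat_symmetric_on hat_sibling_sym (p := p).
apply/exact_gallaiP=> // s t u sp tp up nst ntu nsu.
apply: (exact_gallaiP symA).1; rewrite ?mem_rep_root //.
- exact: rep_neq sp tp nst.
- exact: rep_neq tp up ntu.
- exact: rep_neq sp up nsu.
Qed.

Lemma card_children p : 1 < #|val p| -> #|children p| = #|coarsest col (val p)|.
Proof.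
move=> p1; rewrite -(card_imset _ val_inj); congr #|pred_of_set _|.
apply/setP=> B; apply/imsetP/idP=> [[s + ->]|pB].
  by rewrite childrenE => /andP[].
have bB : block_of col (val p) B by rewrite /block_of /= p1.
by exists (node_sub bB); rewrite ?childrenE.
Qed.

(* A homogeneous partition of the factor at [p] merges the blocks of the coarsest
   partition of [val p] into a coarser homogeneous partition. *)
Lemma children_irreducible p : ~~ leaf p -> irreducible hat (children p).
Proof.
rewrite leafE -ltnNge => p1 [Q [partQ homQ [Q1 [q0 q0Q nq0]]]].
have [/eqP covQ trivQ nQ0] := and3P partQ.
have subQ (q : {set node}) s : q \in Q -> s \in q -> s \in children p.
  by move=> qQ sq; rewrite -covQ; apply/bigcupP; exists q.
have eqQ (q r : {set node}) s : q \in Q -> r \in Q -> s \in q -> s \in r -> q = r.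
  by move=> qQ rQ sq sr; rewrite -(def_pblock trivQ qQ sq) (def_pblock trivQ rQ sr).
(* [U] turns a block of children into the set of vertices that they cover. *)
pose U (q : {set node}) := \bigcup_(s in q) val s.
have eqU q r x : q \in Q -> r \in Q -> x \in U q -> x \in U r -> q = r.
  move=> qQ rQ /bigcupP[s sq xs] /bigcupP[t tr xt].
  have est := children_disjoint (subQ q s qQ sq) (subQ r t rQ tr) xs xt.
  by apply: (eqQ q r s) => //; rewrite est.
have U0 q : q \in Q -> exists x, x \in U q.
  move=> qQ; have /set0Pn[s sq] : q != set0 by apply: contraNneq nQ0 => <-.
  by have /set0Pn[x xs] := node_neq0 s; exists x; apply/bigcupP; exists s.
have injU : {in Q &, injective U}.
  by move=> q r qQ rQ e; have [x xq] := U0 q qQ; apply: (eqU q r x); rewrite -?e.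
have dec : decomposes col [set U q | q in Q] (val p).
  apply/and3P; split; last by rewrite card_in_imset.
    apply/and3P; split.
    - apply/eqP/setP=> x; apply/bigcupP/idP=> [[B /imsetP[q qQ ->] /bigcupP[s sq xs]]|xp].
        have := subQ q s qQ sq; rewrite childrenE => /block_of_proper/proper_sub/subsetP.
        exact.
      have [B pB xB] := block_of_cover col p1 xp.
      have : node_sub pB \in children p by rewrite childrenE.
      rewrite -covQ => /bigcupP[q qQ sq]; exists (U q); first exact: imset_f.
      by apply/bigcupP; exists (node_sub pB).
    - apply/trivIsetP=> B D /imsetP[q qQ ->] /imsetP[r rQ ->] nqr.
      apply/pred0P=> x /=; apply/negP=> /andP[xq xr].
      by case/eqP: nqr; rewrite (eqU q r x).
    - by apply/imsetP=> -[q qQ e]; have [x] := U0 q qQ; rewrite -e inE.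
  apply/homogeneousP=> B D /imsetP[q qQ ->] /imsetP[r rQ ->] nqr x1 y1 x2 y2.
  move=> /bigcupP[s1 s1q x1s] /bigcupP[t1 t1q y1t].
  move=> /bigcupP[s2 s2r x2s] /bigcupP[t2 t2r y2t].
  have nst s t : s \in q -> t \in r -> s != t.
    move=> sq tr; apply: contraNneq nqr => est; apply/eqP; congr U.
    by apply: (eqQ q r s) => //; rewrite est.
  rewrite (hatE (subQ q s1 qQ s1q) (subQ r s2 rQ s2r) (nst _ _ s1q s2r) x1s x2s).
  rewrite (hatE (subQ q t1 qQ t1q) (subQ r t2 rQ t2r) (nst _ _ t1q t2r) y1t y2t).
  by apply: (homQ q r) => //; apply: contraNneq nqr => ->.
have [_ /(_ _ dec)] := coarsestP col p1.
rewrite card_in_imset // -card_children // (card_partition partQ) leqNgt => /negP[].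
have pos q : q \in Q -> 0 < #|q|.
  by move=> qQ; rewrite card_gt0; apply: contraNneq nQ0 => <-.
(* Each block has at least one child and [q0] at least two, so [Q] has fewer blocks than there are
   children, against minimality. *)
rewrite -sum1_card (bigD1 q0) //= [X in _ < X](bigD1 q0) //= -addSn leq_add //.
  by have := pos q0 q0Q; case: #|q0| nq0 => [|[|]].
by apply: leq_sum => q /andP[qQ _]; apply: pos.
Qed.

Lemma children_simple p : ~~ leaf p -> simple hat (children p).
Proof.
move=> nlp; apply: irreducible_simple.
- exact: (hat_symmetric_on hat_sibling_sym (p := p)).
- exact: children_exact_gallai.
- exact: children_irreducible.
move: nlp; rewrite leafE -ltnNge => p1; rewrite card_children //.
by have [/and3P[_ _ ->] _] := coarsestP col p1.
Qed.

Lemma children_colors_disjoint p (q : node) c : ~~ leaf q -> (p < q)%O ->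
  ~~ ((c \in edge_colors hat (children p)) && (c \in edge_colors hat (children q))).
Proof.
move=> nlq pq; apply/negP=> /andP[/edge_colorsP[s [t [sp tp nst cst]]] cq].
have [u pu uq] := exists_child pq.
have sym := hat_symmetric_on hat_sibling_sym (p := q).
(* The child [u] of [q] above [p] meets the color [c], say towards [w]. As [s] and [t] lie inside
   [u], both are joined to [w] by [c], which closes a triangle of color [c]. *)
have [_ _ /(_ c u cq uq)[w [wq nuw cuw]]] := simple_spec sym (children_simple nlq).
have inu v : v \in children p -> rep v \in val u.
  move=> /child_lt/ltW vp; exact: subsetP (le_trans vp pu) _ (mem_rep v).
have cw v : v \in children p -> col (rep v) (rep w) = c.
  by move=> vp; rewrite (hatE uq wq nuw (inu v vp) (mem_rep w)).
have nw v : v \in children p -> rep v != rep w.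
  move=> vp; apply: contraNneq nuw => e; apply/eqP.
  by apply: (children_disjoint uq wq (inu v vp)); rewrite e mem_rep.
apply: (no_monochromatic symA galA (mem_rep_root s) (mem_rep_root t) (mem_rep_root w)
  (rep_neq sp tp nst) (nw t tp) (nw s sp) cst (cw t tp) (cw s sp)).
Qed.

(** The default of [insubd] is the root; for [x] in [A] the singleton is a node and is returned. *)
Definition leaf_node (x : V) : node :=
  insubd (Sub A (connect0 _ _) : node) [set x].

Lemma val_leaf_node x : x \in A -> val (leaf_node x) = [set x].
Proof. by move=> xA; rewrite val_insubd connect_block_set1. Qed.

Lemma leaf_leaf_node x : x \in A -> leaf (leaf_node x).
Proof. by move=> xA; rewrite leafE val_leaf_node // cards1. Qed.

Lemma leaf_node_leaves : leaf_node @: A = leaves node.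
Proof.
apply/setP=> t; rewrite inE; apply/imsetP/idP => [[x xA ->]|].
  exact: leaf_leaf_node.
rewrite leafE => t1; have /set0Pn[x xt] := node_neq0 t.
have xA := subsetP (node_subset t) x xt; exists x => //; apply: val_inj.
rewrite val_leaf_node //; apply/eqP.
by rewrite eq_sym eqEcard sub1set xt cards1 t1.
Qed.

End DecompositionTree.

(** * Equivalence of exact Gallai cliques and leaf graphs *)

Theorem mainTheorem15 (V : finType) (C : eqType) (e : rel V)
    (e_sym : symmetric e) (e_irr : irreflexive e)
    (col : V -> V -> C) (col_e : edge_coloring e col)
    (a : {set V}) (a_clique : is_clique e a) :
  exact_gallai col a <->
  exists (d : Order.disp_t) (T : finPOrderType d) (hat : T -> T -> C),
    [/\ is_tree T,
        two_coloring hat,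
        (exists f : V -> T,
           [/\ {in a &, injective f},
               f @: a = leaves T
             & {in a &, forall x y,
                  x != y -> leaf_color hat (f x) (f y) = col x y}]),
        (forall t : T, ~~ leaf t ->
           irreducible hat (children t) /\ simple hat (children t))
      & (forall t1 t2 : T, ~~ leaf t1 -> ~~ leaf t2 -> (t1 < t2)%O ->
           forall c : C, ~~ ((c \in edge_colors hat (children t1))
                          && (c \in edge_colors hat (children t2))))].
Proof.
have [a0 cliq] := a_clique.
have sym : symmetric_on col a by move=> x y xa ya nxy; apply/col_e/cliq.
split=> [gal|[d [T [hat [treeT [hat_sym _] [f [injf fa fcol]] irrT colT]]]]]; last first.
  apply/exact_gallaiP=> // x y z xa ya za nxy nyz nxz.
  have lf u : u \in a -> leaf (f u).
    by move=> ua; have := imset_f f ua; rewrite fa inE.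
  have nf u v : u \in a -> v \in a -> u != v -> f u != f v.
    by move=> ua va; apply: contraNneq => /injf->.
  rewrite -!fcol //; apply: leaf_color_two_colored; rewrite ?lf ?nf //.
  by move=> t /irrT[].
(* The vertex [x0] supplies the default value in [rep]. *)
have /set0Pn[x0 _] := a0.
exists node_display, (node col a), (@hat _ _ _ _ x0); split.
- exact: node_tree.
- split; first exact: hat_sibling_sym.
  move=> t nlt; have hsym := hat_sibling_sym a0 sym x0.
  by have [_ ? _] := simple_spec (hat_symmetric_on hsym (p := t))
    (children_simple a0 sym x0 gal nlt).
- exists (leaf_node col a); split; last 1 first.
  + move=> x y xa ya nxy; apply: leaf_color_node => //;
      by rewrite ?val_leaf_node ?leaf_leaf_node.
  + by move=> x y xa ya /(congr1 val); rewrite !val_leaf_node // => /set1_inj.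
  + exact: leaf_node_leaves.
- by move=> t nlt; split; [apply: children_irreducible | apply: children_simple].
- by move=> p q _ nlq pq c; apply: children_colors_disjoint.
Qed.
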